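(* Let $n$ be a positive integer. A linear map $\phi:\mathbf{DS}_n\to\mathbf{DS}_n$ preserves the spectrum, that is, $$\operatorname{spec}(\phi(A))=\operatorname{spec}(A)\qquad\text{for all }A\in\mathbf{DS}_n,$$ if and only if there is a permutation matrix $P\in\mathbf{P}_n$ such that either $\phi(A)=PAP^t$ for all $A\in\mathbf{DS}_n$, or $\phi(A)=PA^tP^t$ for all $A\in\mathbf{DS}_n$.
   Context: $\mathbf{DS}_n$ is the set of $n\times n$ doubly stochastic matrices (real, entrywise nonnegative, all row sums and all column sums equal to $1$) and $\mathbf{P}_n$ is the set of $n\times n$ permutation matrices. $A^t$ is the transpose of $A$. $\operatorname{spec}(A)$ is the spectrum (multiset of complex eigenvalues) of $A$ counting multiplicities. For subsets $S,T$ of real vector spaces, a function $\phi:S\to T$ is called linear if it can be extended to an $\mathbb{R}$-linear map from the real span of $S$ to the real span of $T$. *)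

(* Defs.v *)
From HB Require Import structures.
From mathcomp Require Import all_boot all_order all_algebra.
From mathcomp Require Import finmap multiset.
From mathcomp Require Import classical_sets reals.
From mathcomp Require Import complex.

Set Implicit Arguments.
Unset Strict Implicit.
Unset Printing Implicit Defensive.

Import GRing.Theory Num.Theory.

Local Open Scope mset_scope.
Local Open Scope classical_set_scope.
Local Open Scope ring_scope.

Definition doubly_stochastic (R : realType) (n : nat) : set 'M[R]_n :=
  [set A | [/\ forall i j, 0 <= A i j,
               forall i, \sum_j A i j = 1
             & forall j, \sum_i A i j = 1]].
Arguments doubly_stochastic R n : clear implicits.

Definition real_span (R : realType) (V : lmodType R) (S : set V) : set V :=
  [set x | exists (k : nat) (c : 'I_k -> R) (v : 'I_k -> V),
     (forall i, S (v i)) /\ x = \sum_(i < k) c i *: v i].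

(* A map between subsets (or subspaces) is represented by a total function
   whose values outside the source are irrelevant: phi stands for a map S -> T
   and L for an R-linear map from the span of S to the span of T. *)
Definition linear_on (R : realType) (V W : lmodType R)
    (S : set V) (T : set W) (phi : V -> W) : Prop :=
  exists L : V -> W,
    [/\ forall x, real_span S x -> real_span T (L x),
        forall (a : R) x y, real_span S x -> real_span S y ->
          L (a *: x + y) = a *: L x + L y
      & forall x, S x -> L x = phi x].

(* The chosen sequence lists the complex roots of the characteristic
   polynomial, each repeated according to its (algebraic) multiplicity. *)
Definition spec (R : realType) (n : nat) (A : 'M[R]_n) : {mset R[i]} :=
  seq_mset (sval (closed_field_poly_normal
    (char_poly (map_mx (real_complex R) A)))).

(* Main.v *)
Require Import Defs.
From mathcomp Require Import all_boot all_order all_algebra.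
From mathcomp Require Import all_fingroup.
From mathcomp Require Import classical_sets reals.
From mathcomp Require Import multiset complex.
From mathcomp Require Import finset.
From mathcomp Require Import ring lra.

(** The spectrum determines [\tr A] and [\tr (A *m A)].  Polarising the second
invariant along the midpoint of [A] and [B] shows that a linear spectrum
preserver [phi] satisfies [\tr (phi A *m phi B) = \tr (A *m B)] on doubly
stochastic matrices.  The trace and this pairing already force the conclusion,
for any self-map of the doubly stochastic matrices ([trace_isometryP]).

A doubly stochastic matrix of trace [n] is the identity, and if two doubly
stochastic matrices are inverse to each other then both are permutation
matrices; hence [phi] sends permutation matrices to permutation matrices, say
[perm_mx s] to [perm_mx (f s)].  Since [\tr] counts fixed points, [f] fixes the
identity and is an isometry of the symmetric group for the Hamming distance.

Such an [f] permutes the transpositions, that is, the edges of the complete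
graph, and it keeps track of which edges meet.  This is an automorphism of a
line graph; it comes from a permutation of the vertices because the edges of a
triangle cannot be sent to three edges with a common end [x].  Indeed a 3-cycle
multiplied by any transposition of its triangle is again a transposition,
whereas for the image [q] of this 3-cycle the other end of each of the three
edges would have to be [q x] or [q^-1 x] ([trace_isometry_tperm]).  After
conjugation, [phi] therefore fixes every transposition.

Pairing with the transpositions gives the entries of the symmetric part of a
matrix, so now [phi A + (phi A)^T = A + A^T].  In particular each 3-cycle is
fixed or inverted, and comparing 3-cycles through a base point shows that the
same alternative holds for all of these ([trace_isometry_cycle3]).  In the first
case [phi A - A], in the second [phi A - A^T], is an antisymmetric matrix with
zero row sums that is orthogonal to the 3-cycles through the base point; only
the zero matrix is ([antisym_cycle3_eq0]).  This reaches all doubly stochastic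
matrices at once, without decomposing them into permutation matrices. *)

Set Implicit Arguments.
Unset Strict Implicit.
Unset Printing Implicit Defensive.

Import Order.TTheory GRing.Theory Num.Theory.

Local Open Scope ring_scope.

(** * Traces determined by the spectrum *)

Lemma char_poly_conj (F : comNzRingType) n (P Q A : 'M[F]_n) :
  P *m Q = 1%:M -> char_poly (P *m A *m Q) = char_poly A.
Proof.
move=> PQ1.
have PQX : map_mx polyC P *m map_mx polyC Q = 1%:M.
  by rewrite -map_mxM PQ1 map_mx1.
rewrite /char_poly.
have -> : char_poly_mx (P *m A *m Q)
    = map_mx polyC P *m char_poly_mx A *m map_mx polyC Q.
  rewrite /char_poly_mx !map_mxM mulmxBr mulmxBl scalar_mxC -(mulmxA 'X%:M) PQX.
  by rewrite mulmx1.
by rewrite !det_mulmx mulrAC -det_mulmx PQX det1 mul1r.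
Qed.

Lemma char_poly_tr (F : comNzRingType) n (A : 'M[F]_n) :
  char_poly A^T = char_poly A.
Proof.
rewrite /char_poly -[RHS]det_tr; congr (\det _).
by rewrite /char_poly_mx linearB /= tr_scalar_mx map_trmx.
Qed.

(** This is the determinant of [X^2 - A^2 = (X - A)(X + A)], the last factor being
minus the value of [X - A] at [- X]. *)
Lemma char_poly_sqr (F : comNzRingType) n (A : 'M[F]_n) :
  char_poly (A *m A) \Po 'X^2 =
  (-1) ^+ n * (char_poly A * (char_poly A \Po (- 'X))).
Proof.
set XA := map_mx polyC A.
have e1 : map_mx (comp_poly 'X^2) (char_poly_mx (A *m A)) =
          char_poly_mx A *m ('X%:M + XA).
  rewrite /char_poly_mx map_mxB map_scalar_mx /= comp_polyX.
  rewrite map_mxM mulmxDr !mulmxBl -/XA (scalar_mxC _ XA).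
  rewrite addrA subrK -scalar_mxM.
  by congr (_ - _); rewrite map_mxM; congr (_ *m _);
     apply/matrixP=> i j; rewrite !mxE /= comp_polyC.
have e2 : map_mx (comp_poly (- 'X)) (char_poly_mx A) = (-1) *: ('X%:M + XA).
  rewrite /char_poly_mx map_mxB map_scalar_mx /= comp_polyX.
  by apply/matrixP=> i j; rewrite !mxE /= comp_polyC mulN1r opprD mulNrn.
rewrite /char_poly -!det_map_mx /= e1 e2 det_mulmx detZ.
by rewrite [RHS]mulrCA [X in _ = _ * X]mulrA -expr2 sqrr_sign mul1r.
Qed.

(** The characteristic polynomial of [A *m A] is a function of that of [A], which
makes eigenvalues unnecessary and keeps the result valid over any commutative
ring. *)
Lemma char_poly_mxtrace_sqr (F : comNzRingType) n (A B : 'M[F]_n) :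
  char_poly A = char_poly B -> \tr (A *m A) = \tr (B *m B).
Proof.
case: n A B => [|n] A B eqAB; first by rewrite /mxtrace !big_ord0.
apply: oppr_inj; rewrite -!char_poly_trace //=.
have := char_poly_sqr A; rewrite eqAB -char_poly_sqr.
move=> /(congr1 (fun p : {poly F} => p`_(n * 2)%N)).
by rewrite !coef_comp_poly_Xn // dvdn_mull // mulnK.
Qed.

Lemma char_poly_mxtrace (F : comNzRingType) n (A B : 'M[F]_n) :
  char_poly A = char_poly B -> \tr A = \tr B.
Proof.
case: n A B => [|n] A B eqAB; first by rewrite /mxtrace !big_ord0.
by apply: oppr_inj; rewrite -!char_poly_trace // eqAB.
Qed.

Lemma spec_char_polyP (R : realType) n (A B : 'M[R]_n) :
  spec A = spec B <-> char_poly A = char_poly B.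
Proof.
rewrite /spec -!map_char_poly; split=> [/esym eqAB|-> //].
apply: (map_poly_inj (real_complex R)) => /=.
set pA := map_poly _ (char_poly A) in eqAB *.
set pB := map_poly _ (char_poly B) in eqAB *.
have monA : lead_coef pA = 1.
  by apply/eqP; rewrite -monicE monic_map ?char_poly_monic.
have monB : lead_coef pB = 1.
  by apply/eqP; rewrite -monicE monic_map ?char_poly_monic.
move: eqAB.
case: (closed_field_poly_normal pA) => rA eA.
case: (closed_field_poly_normal pB) => rB eB /=.
move=> /eq_seq_msetP eqr; rewrite eA eB monA monB.
by congr (_ *: _); apply: perm_big; rewrite perm_sym.
Qed.

(** * Permutation matrices and fixed points *)

Lemma perm_mxE (F : pzSemiRingType) n (s : 'S_n) i j :
  perm_mx s i j = (s i == j)%:R :> F.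
Proof. by rewrite !mxE. Qed.

Lemma mulmx_permE (F : pzSemiRingType) n (A : 'M[F]_n) (s : 'S_n) i j :
  (A *m perm_mx s) i (s j) = A i j.
Proof.
rewrite !mxE (bigD1 j) //= big1 ?perm_mxE ?eqxx ?mulr1 ?addr0 // => k nkj.
by rewrite perm_mxE (inj_eq perm_inj) (negPf nkj) mulr0.
Qed.

(** [1%:M - perm_mx (tperm i j)] is the rank one matrix of [e_i - e_j], hence only
four entries of [A] occur besides the trace. *)
Lemma mxtrace_mul_tperm (F : comPzRingType) n (A : 'M[F]_n) i j :
  \tr (A *m perm_mx (tperm i j)) = \tr A + A i j + A j i - A i i - A j j.
Proof.
have [->|nij] := eqVneq i j; first by rewrite tperm1 perm_mx1 mulmx1; ring.
have trE (B : 'M[F]_n) :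
    \tr B = B i i + (B j j + \sum_(k | (k != i) && (k != j)) B k k).
  by rewrite /mxtrace (bigD1 i) //= (bigD1 j) // eq_sym.
rewrite (trE (_ *m _)) (trE A).
rewrite -{3}[ i](tpermR i j) mulmx_permE -{4}[j](tpermL i j) mulmx_permE.
rewrite (eq_bigr (fun k => A k k)) => [|k /andP[nki nkj]]; first by ring.
by rewrite -{2}[k](@tpermD _ i j) 1?eq_sym // mulmx_permE.
Qed.

(** Permutations compose from left to right, so this is the cycle
[i -> j -> k -> i]. *)
Definition cycle3 n (i j k : 'I_n) : 'S_n := (tperm i j * tperm i k)%g.

Lemma cycle3E n (i j k x : 'I_n) : i != j -> j != k -> i != k ->
  cycle3 i j k x =
    if x == i then j else if x == j then k else if x == k then i else x.
Proof.
move=> nij njk nik; rewrite /cycle3 permM.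
have [->|nxi] := eqVneq x i; first by rewrite tpermL tpermD // eq_sym.
have [->|nxj] := eqVneq x j; first by rewrite tpermR tpermL.
rewrite (tpermD (x := i) (y := j)) 1?eq_sym //.
have [->|nxk] := eqVneq x k; first by rewrite tpermR.
by rewrite tpermD // eq_sym.
Qed.

Lemma mxtrace_mul_cycle3 (F : comPzRingType) n (A : 'M[F]_n) i j k :
  i != j -> j != k -> i != k ->
  \tr (A *m perm_mx (cycle3 i j k)) =
  \tr A + A j i + A k j + A i k - A i i - A j j - A k k.
Proof.
move=> nij njk nik; rewrite /cycle3 perm_mxM mulmxA !mxtrace_mul_tperm.
set AT := A *m _.
have ATi x : AT x i = A x j by rewrite -{1}[ i](tpermR i j) mulmx_permE.
have ATk x : AT x k = A x k.
  have {1}<- : tperm i j k = k by rewrite tpermD.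
  by rewrite mulmx_permE.
by rewrite !ATi !ATk; ring.
Qed.

Lemma mxtrace_perm_mx (F : pzSemiRingType) n (s : 'S_n) :
  \tr (perm_mx s : 'M[F]_n) = #|[set x | s x == x]|%:R.
Proof.
rewrite /mxtrace -sum1_card natr_sum [RHS]big_mkcond /=; apply: eq_bigr => i _.
by rewrite perm_mxE inE; case: eqP.
Qed.

Lemma cards2_eq (T : finType) (B : {set T}) x y :
  #|B| = 2 -> x \in B -> y \in B -> x != y -> B = [set x; y].
Proof.
move=> cB xB yB nxy; apply/eqP; rewrite eq_sym eqEcard cB cards2 nxy andbT.
by apply/fintype.subsetP=> z; rewrite !inE => /orP[] /eqP->.
Qed.

Lemma perm_support2 (T : finType) (q : {perm T}) :
  #|[set x | q x != x]| = 2 -> exists x y, x != y /\ q = tperm x y.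
Proof.
move=> /eqP/cards2P[x [y [nxy eS]]]; exists x, y; split=> //.
have supp z : (q z != z) = (z == x) || (z == y).
  by have := in_set2 z x y; rewrite -eS inE.
have qS z : q z != z -> q (q z) != q z by rewrite (inj_eq perm_inj).
have qx : q x = y.
  have qxx : q x != x by rewrite supp eqxx.
  by have := qS _ qxx; rewrite supp (negPf qxx) /= => /eqP.
have qy : q y = x.
  have qyy : q y != y by rewrite supp eqxx orbT.
  by have := qS _ qyy; rewrite supp (negPf qyy) orbF => /eqP.
apply/permP=> z; case: tpermP => [->|->|/eqP zx /eqP zy] //.
by apply/eqP; rewrite -[_ == _]negbK supp negb_or zx zy.
Qed.

Lemma mxtrace_perm_tperm (F : numDomainType) n (i j : 'I_n) (q : 'S_n) :
  i != j -> \tr (perm_mx q : 'M[F]_n) = \tr (perm_mx (tperm i j) : 'M[F]_n) ->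
  exists x y, x != y /\ q = tperm x y.
Proof.
move=> nij; rewrite -[perm_mx (tperm i j)]mul1mx mxtrace_mul_tperm mxtrace1.
rewrite !mxE !eqxx (eq_sym j i) (negPf nij) /= mxtrace_perm_mx => fixq.
apply: perm_support2; apply/eqP; rewrite -(eqr_nat F).
have -> : [set x | q x != x] = ~: [set x | q x == x].
  by apply/setP=> x; rewrite !inE.
have := cardsC [set x | q x == x]; rewrite card_ord => cC.
apply/eqP; have /(congr1 (fun m => m%:R : F)) := cC; rewrite natrD fixq => e.
by apply: (addrI (n%:R + 0 + 0 - 1 - 1 : F)); rewrite e; ring.
Qed.

Lemma cards1I (T : finType) x (B : {set T}) : #|[set x] :&: B| = (x \in B).
Proof.
case: (boolP (x \in B)) => xB; first by rewrite (setIidPl _) ?cards1 ?sub1set.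
by apply/eqP; rewrite cards_eq0 setI_eq0 disjoints1.
Qed.

(** The number of common points enters through the squared inner product of
[e_i - e_j] and [e_k - e_l]. *)
Lemma mxtrace_tperm2 (F : comNzRingType) n (i j k l : 'I_n) :
  i != j -> k != l ->
  \tr (perm_mx (tperm i j) *m perm_mx (tperm k l) : 'M[F]_n) =
  n%:R - 4%:R + (#|[set i; j] :&: [set k; l]| ^ 2)%:R.
Proof.
move=> nij nkl; rewrite mxtrace_mul_tperm -[perm_mx (tperm i j)]mul1mx.
rewrite mxtrace_mul_tperm mxtrace1 mul1mx !perm_mxE !mxE !eqxx.
rewrite (eq_sym j i) (negPf nij).
have -> : #|[set i; j] :&: [set k; l]| =
    ((k \in [set i; j]) + (l \in [set i; j]))%N.
  rewrite setIC setIUl cardsU (_ : _ :&: _ :&: _ = set0) ?cards0 ?subn0;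
    last first.
    apply/setP=> z; rewrite !inE; case: (eqVneq z k) => [->|] //.
    by rewrite (negPf nkl) andbF.
  by rewrite !cards1I.
rewrite !inE.
have nlk : l != k by rewrite eq_sym.
have nji : j != i by rewrite eq_sym.
have [eki|nki] := eqVneq k i; have [ekj|nkj] := eqVneq k j;
have [eli|nli] := eqVneq l i; have [elj|nlj] := eqVneq l j; subst;
  try by rewrite ?eqxx in nij nkl nlk nji.
all: rewrite ?tpermL ?tpermR ?tpermD 1?eq_sym // ?eqxx ?(negPf nkl) ?(negPf nlk)
  ?(negPf nij) ?(negPf nji) /=.
all: try rewrite (negPf nlj); try rewrite (negPf nli).
all: try rewrite (eq_sym j k) (negPf nkj); try rewrite (eq_sym i k) (negPf nki).
all: by rewrite ?addn0 ?add0n /=; ring.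
Qed.

(** * Edge maps induced by vertex permutations *)

Lemma cards2I (T : finType) (i j k : T) :
  j != k -> #|[set i; j] :&: [set i; k]| = 1.
Proof.
move=> njk; rewrite -setUIr (_ : _ :&: _ = set0) ?setU0 ?cards1 //.
by apply/eqP; rewrite setI_eq0 disjoints1 inE.
Qed.

(** A form of Whitney's theorem on line graphs of complete graphs.  Excluding
triangles sent to stars is what rules out the exceptional automorphisms on four
vertices.  The vertex [i] goes to the common end of the images of the edges at
[i]; this map is injective because two vertices with the same image would turn
a triangle on them into a star. *)
Lemma edge_map_perm (T : finType) (S : T -> T -> {set T}) :
  (forall i j k l, i != j -> k != l ->
     #|S i j :&: S k l| = #|[set i; j] :&: [set k; l]|) ->
  (forall i j k x, i != j -> j != k -> i != k ->
     x \in S i j -> x \in S j k -> x \in S i k -> False) ->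
  exists s : {perm T}, forall i j, i != j -> S i j = [set s i; s j].
Proof.
move=> SI Stri.
have S2 i j : i != j -> #|S i j| = 2.
  by move=> nij; rewrite -[S i j]setIid SI // setIid cards2 nij.
have SC i j : i != j -> S i j = S j i.
  move=> nij; have nji : j != i by rewrite eq_sym.
  have sub k l : k != l -> S k l \subset S l k.
    move=> nkl; have nlk : l != k by rewrite eq_sym.
    apply/setIidPl/eqP; rewrite eqEcard subsetIl SI // S2 //.
    by rewrite [[set l; k]]setUC setIid cards2 nkl.
  by apply/eqP; rewrite eqEsubset !sub.
(* With at most two vertices there is at most one edge. *)
have [cT|cT] := leqP #|T| 2.
  exists 1%g => i j nij; rewrite !perm1.
  have full (B : {set T}) : #|B| = 2 -> B = setT.
    by move=> cB; apply/eqP; rewrite eqEcard finset.subsetT cardsT cB.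
  by rewrite (full (S i j)) ?S2 // (full [set i; j]) // cards2 nij.
have third (i j : T) : exists k, k != i /\ k != j.
  have /card_gt0P[k] : (0 < #|~: [set i; j]|)%N.
    by rewrite cardsCs setCK cards2 subn_gt0; apply: leq_trans cT; case: eqP.
  by rewrite !inE negb_or => /andP[nki nkj]; exists k.
have meet1 i j k : i != j -> j != k -> i != k ->
    exists x, S i j :&: S i k = [set x].
  by move=> nij njk nik; apply/cards1P; rewrite SI // cards2I.
have center i : exists x, forall j, i != j -> x \in S i j.
  have [j [nji _]] := third i i; have [k [nki nkj]] := third i j.
  have [nij njk nik] : [/\ i != j, j != k & i != k] by split; rewrite eq_sym.
  have [x Sx] := meet1 _ _ _ nij njk nik; exists x => l nil.
  have [xij xik] : x \in S i j /\ x \in S i k by apply/setIP; rewrite Sx set11.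
  have [<-//|njl] := eqVneq j l; have [<-//|nkl] := eqVneq k l.
  (* If [S i l] avoids [x], it meets [S i j] at its other end [y].  Now [S j k]
  avoids [x] too, a triangle not becoming a star, so it also contains [y],
  although the edges [i l] and [j k] are disjoint. *)
  apply/negPn/negP => nxl.
  have [y /setP/(_ y)] := meet1 _ _ _ nij njl nil.
  rewrite !inE eqxx => /andP[yij yil].
  have [z /setP/(_ z)] := meet1 _ _ _ nji nik njk.
  rewrite !inE eqxx -SC // => /andP[zij zjk].
  have nzx : z != x by apply/eqP=> zx; apply: (Stri i j k x) => //; rewrite -zx.
  have nyx : y != x by apply: contraNneq nxl => <-.
  have Sij : S i j = [set x; y] by apply: cards2_eq; rewrite ?S2 // eq_sym.
  move: zij; rewrite Sij !inE (negPf nzx) /= => /eqP ezy.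
  have : #|S i l :&: S j k| = 0.
    rewrite SI //; apply/eqP; rewrite cards_eq0; apply/eqP/setP => w.
    rewrite !inE.
    case: eqVneq => [->|_] /=; first by rewrite (negPf nij) (negPf nik).
    by case: eqVneq => //= ->; rewrite !(eq_sym l) (negPf njl) (negPf nkl).
  by move/eqP; rewrite cards_eq0 => /eqP/setP/(_ y); rewrite !inE yil -ezy zjk.
have [s sS] := fin_all_exists center.
have s_inj : injective s.
  move=> i j eqs; apply/eqP/negPn/negP => nij; have [k [nki nkj]] := third i j.
  have [njk nik] : j != k /\ i != k by split; rewrite eq_sym.
  apply: (Stri i j k (s i)) => //; first exact: sS.
    by rewrite eqs; exact: sS.
  exact: sS.
exists (perm s_inj) => i j nij; rewrite !permE.
apply: cards2_eq; rewrite ?S2 ?sS //.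
  by rewrite SC // sS // eq_sym.
by rewrite (inj_eq s_inj).
Qed.

(** * Doubly stochastic matrices *)

Lemma doubly_stochastic_le1 (R : realType) n (A : 'M[R]_n) i j :
  doubly_stochastic R n A -> A i j <= 1.
Proof.
by move=> [A0 Ar _]; rewrite -(Ar i) (bigD1 j) //= lerDl sumr_ge0.
Qed.

Lemma doubly_stochastic_entry1 (R : realType) n (A : 'M[R]_n) i j :
  doubly_stochastic R n A -> A i j = 1 -> forall k, A i k = (j == k)%:R.
Proof.
move=> [A0 Ar _] Aij k; have [<-//|njk] := eqVneq.
have := Ar i; rewrite (bigD1 j) //= Aij => /(canRL (addKr _)).
rewrite addNr => e.
by apply: (psumr_eq0P _ e) => //; rewrite eq_sym.
Qed.

Lemma doubly_stochastic_perm (R : realType) n (s : 'S_n) :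
  doubly_stochastic R n (perm_mx s).
Proof.
split=> [i j|i|j]; first by rewrite perm_mxE ler0n.
  rewrite (bigD1 (s i)) //= perm_mxE eqxx big1 ?addr0 // => k nk.
  by rewrite perm_mxE eq_sym (negPf nk).
rewrite (bigD1 (s^-1 j)%g) //= perm_mxE permKV eqxx big1 ?addr0 // => k nk.
by rewrite perm_mxE; case: eqP => // e; rewrite -e permK eqxx in nk.
Qed.

Lemma doubly_stochastic_mul (R : realType) n (A B : 'M[R]_n) :
  doubly_stochastic R n A -> doubly_stochastic R n B ->
  doubly_stochastic R n (A *m B).
Proof.
move=> [A0 Ar Ac] [B0 Br Bc]; split=> [i j|i|j].
- by rewrite mxE sumr_ge0 // => k _; rewrite mulr_ge0.
- under eq_bigr do rewrite mxE.
  by rewrite exchange_big /=; under eq_bigr do rewrite -mulr_sumr Br mulr1.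
under eq_bigr do rewrite mxE.
by rewrite exchange_big /=; under eq_bigr do rewrite -mulr_suml Ac mul1r.
Qed.

Lemma doubly_stochastic_tr (R : realType) n (A : 'M[R]_n) :
  doubly_stochastic R n A -> doubly_stochastic R n A^T.
Proof.
move=> [A0 Ar Ac]; split=> [i j|i|j]; first by rewrite mxE.
  by under eq_bigr do rewrite mxE.
by under eq_bigr do rewrite mxE.
Qed.

Lemma doubly_stochastic_trace1 (R : realType) n (A : 'M[R]_n) :
  doubly_stochastic R n A -> \tr A = n%:R -> A = 1%:M.
Proof.
move=> Ads trA; apply/matrixP=> i j; rewrite mxE.
apply: doubly_stochastic_entry1 => //.
have sum0 : \sum_k (1 - A k k) = 0.
  by rewrite sumrB sumr_const card_ord -/(\tr A) trA subrr.
apply/eqP; rewrite eq_sym -subr_eq0; apply/eqP.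
apply: (psumr_eq0P _ sum0) => // k _.
by rewrite subr_ge0 doubly_stochastic_le1.
Qed.

(** The equation [1 = \sum_k A i k * B k i] writes 1 as an average of entries of
[B], all at most 1; so [B k i = 1] as soon as [A i k != 0]. *)
Lemma doubly_stochastic_inv_perm (R : realType) n (A B : 'M[R]_n) :
  doubly_stochastic R n A -> doubly_stochastic R n B -> A *m B = 1%:M ->
  exists s, B = perm_mx s.
Proof.
move=> Ads Bds AB1; have [A0 Ar _] := Ads.
have ones i : exists j, B j i = 1.
  have [j nAij] : exists j, A i j != 0.
    apply/existsP; rewrite -[[exists _, _]]negbK; apply/negP => /existsPn Ai0.
    have := Ar i; rewrite big1 => [/eqP|j _]; first by rewrite eq_sym oner_eq0.
    by apply/eqP; rewrite -[_ == _]negbK Ai0.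
  exists j.
  have sum0 : \sum_k A i k * (1 - B k i) = 0.
    under eq_bigr do rewrite mulrBr mulr1.
    rewrite sumrB Ar; have /matrixP/(_ i i) := AB1; rewrite !mxE eqxx /= => ->.
    by rewrite subrr.
  have /(_ j isT)/eqP : forall k, true -> A i k * (1 - B k i) = 0.
    apply: (psumr_eq0P _ sum0) => k _.
    by rewrite mulr_ge0 // subr_ge0 doubly_stochastic_le1.
  by rewrite mulf_eq0 (negPf nAij) subr_eq0 => /eqP.
have [g gB] := fin_all_exists ones.
have rowB i := doubly_stochastic_entry1 Bds (gB i).
have g_inj : injective g.
  move=> i j eg; apply/eqP; have := gB j; rewrite -eg rowB => /eqP.
  by rewrite -[1](mulr1n 1) eqr_nat; case: (i == j).
exists (perm g_inj)^-1%g; apply/matrixP=> i j; rewrite perm_mxE.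
by have := rowB ((perm g_inj)^-1%g i) j; rewrite -(permE g_inj) permKV => ->.
Qed.

(** * Maps preserving traces of products *)

(** On permutation matrices the last clause preserves the number of agreements of
[s^-1] and [t], so it is a Hamming isometry condition. *)
Definition trace_isometry (R : realType) n (psi : 'M[R]_n -> 'M[R]_n) : Prop :=
  [/\ forall A, doubly_stochastic R n A -> doubly_stochastic R n (psi A),
      forall A, doubly_stochastic R n A -> \tr (psi A) = \tr A
    & forall A B, doubly_stochastic R n A -> doubly_stochastic R n B ->
        \tr (psi A *m psi B) = \tr (A *m B)].

(** [psi] maps [perm_mx s] and [perm_mx s^-1] to matrices whose product has trace
[n], hence to mutually inverse matrices. *)
Lemma trace_isometry_perm (R : realType) n (psi : 'M[R]_n -> 'M[R]_n) :
  trace_isometry psi ->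
  exists f : 'S_n -> 'S_n, forall s, psi (perm_mx s) = perm_mx (f s).
Proof.
move=> [psiDS psitr psimul].
suff ex s : exists t, psi (perm_mx s) = perm_mx t.
  by have [f fP] := fin_all_exists ex; exists f.
have Ps := doubly_stochastic_perm R s.
have PsV := doubly_stochastic_perm R s^-1.
have [dsV ds] := (psiDS _ PsV, psiDS _ Ps).
apply: (doubly_stochastic_inv_perm dsV ds); apply: doubly_stochastic_trace1.
  exact: doubly_stochastic_mul.
by rewrite psimul // -perm_mxM mulVg perm_mx1 mxtrace1.
Qed.

(** Transpositions are the permutations with [n - 2] fixed points, and pairing two
of them tells whether they share a point; the graph-theoretic part is
[edge_map_perm]. *)
Lemma trace_isometry_tperm (R : realType) n (psi : 'M[R]_n -> 'M[R]_n) :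
  trace_isometry psi -> exists s : 'S_n, forall i j, i != j ->
    psi (perm_mx (tperm i j)) = perm_mx (tperm (s i) (s j)).
Proof.
move=> psiP; have [f fP] := trace_isometry_perm psiP.
have [psiDS psitr psimul] := psiP.
have Pds (s : 'S_n) := doubly_stochastic_perm R s.
have ftperm i j : i != j -> exists x y, x != y /\ f (tperm i j) = tperm x y.
  move=> nij; apply: (mxtrace_perm_tperm (F := R) nij).
  by rewrite -fP psitr.
have suppT (x y : 'I_n) : x != y -> [set z | tperm x y z != z] = [set x; y].
  move=> nxy; apply/setP=> z; rewrite !inE.
  by case: tpermP => [->|->|/eqP/negPf-> /eqP/negPf->];
     rewrite ?eqxx ?orbT ?nxy // eq_sym nxy.
(* A transposition is encoded by its support, the edge that it swaps. *)
pose S i j := [set z | f (tperm i j) z != z].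
have SE i j : i != j ->
    exists x y, [/\ x != y, f (tperm i j) = tperm x y & S i j = [set x; y]].
  move=> nij; have [x [y [nxy fxy]]] := ftperm _ _ nij; exists x, y; split=> //.
  by rewrite /S fxy suppT.
have SI i j k l : i != j -> k != l ->
    #|S i j :&: S k l| = #|[set i; j] :&: [set k; l]|.
  move=> nij nkl; have [x [y [nxy fxy ->]]] := SE _ _ nij.
  have [z [t [nzt fzt ->]]] := SE _ _ nkl.
  have := psimul _ _ (Pds (tperm i j)) (Pds (tperm k l)).
  rewrite !fP fxy fzt !mxtrace_tperm2 // => /addrI/eqP.
  by rewrite eqr_nat eqn_sqr => /eqP.
have Stri i j k x : i != j -> j != k -> i != k ->
    x \in S i j -> x \in S j k -> x \in S i k -> False.
  move=> nij njk nik.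
  (* Each edge [x y] of the image forces [y = q x] or [y = q^-1 x]; three edges
  at [x] would give three distinct such [y]. *)
  pose c := cycle3 i j k; pose q := f c.
  have edge a b : a != b -> c a = b \/ c b = a -> c a != a -> c b != b ->
     x \in S a b ->
     exists y, [/\ y != x, y \in S a b & y = q x \/ y = q^-1%g x].
    move=> nab cab nca ncb; have [u [v [nuv fuv Suv]]] := SE _ _ nab.
    have : \tr (perm_mx q *m perm_mx (tperm u v) : 'M[R]_n) =
           \tr (perm_mx c *m perm_mx (tperm a b)).
      by rewrite -fuv -!fP psimul.
    rewrite !mxtrace_mul_tperm -fP psitr // -/c !fP -/q.
    rewrite !perm_mxE (negPf nca) (negPf ncb).
    have cab1 : 1 <= (c a == b)%:R + (c b == a)%:R :> R.
      by case: cab => ->; rewrite eqxx ?lerDl ?lerDr ler0n.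
    have [qu0 qv0] : 0 <= (q u == u)%:R :> R /\ 0 <= (q v == v)%:R :> R.
      by rewrite !ler0n.
    move=> e; have quv : q u = v \/ q v = u.
      case: (eqVneq (q u) v) => [|nquv]; first by left.
      case: (eqVneq (q v) u) => [|nqvu]; first by right.
      move: e cab1 qu0 qv0; rewrite (negPf nquv) (negPf nqvu) /=.
      move: (\tr _) (c a == b)%:R (c b == a)%:R (q u == u)%:R (q v == v)%:R.
      by clear=> *; exfalso; lra.
    rewrite Suv !inE => /orP[] /eqP->.
      exists v; rewrite !inE eqxx orbT eq_sym; split=> //.
      by case: quv => <-; [left|right; rewrite permK].
    exists u; rewrite !inE eqxx nuv; split=> //.
    by case: quv => <-; [right; rewrite permK|left].
  have [nji nkj nki] : [/\ j != i, k != j & k != i] by split; rewrite eq_sym.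
  have ci : c i = j by rewrite cycle3E // eqxx.
  have cj : c j = k by rewrite cycle3E // (negPf nji) eqxx.
  have ck : c k = i by rewrite cycle3E // (negPf nki) (negPf nkj) eqxx.
  move=> xij xjk xik.
  case: (edge _ _ _ _ _ _ xij)=> [||||y1 [n1 S1 q1]];
    rewrite ?ci ?cj ?ck //; first by left.
  case: (edge _ _ _ _ _ _ xjk)=> [||||y2 [n2 S2 q2]];
    rewrite ?ci ?cj ?ck //; first by left.
  case: (edge _ _ _ _ _ _ xik)=> [||||y3 [n3 S3 q3]];
    rewrite ?ci ?cj ?ck //; first by right.
  have distinct a b d e y y' : a != b -> d != e ->
      #|[set a; b] :&: [set d; e]| = 1 -> x \in S a b -> x \in S d e ->
      y != x -> y \in S a b -> y' \in S d e -> y != y'.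
    move=> nab nde; rewrite -SI // => /eqP/cards1P[w Sw] xab xde nyx yab yde.
    apply: contraNneq nyx => eyy.
    have /set1P-> : y \in [set w] by rewrite -Sw inE yab eyy.
    by apply/eqP/esym/set1P; rewrite -Sw inE xab.
  have n12 : y1 != y2.
    by apply: (distinct i j j k) => //; rewrite [[set i; j]]setUC cards2I.
  have n23 : y2 != y3.
    by apply: (distinct j k i k) => //; rewrite setUC [[set i; k]]setUC cards2I.
  have n13 : y1 != y3 by apply: (distinct i j i k); rewrite ?cards2I.
  move: n12 n23 n13.
  by case: q1 => ->; case: q2 => ->; case: q3 => ->; rewrite eqxx.
have [s sS] := edge_map_perm SI Stri.
exists s => i j nij; rewrite fP; congr perm_mx.
have [x [y [nxy -> Sxy]]] := SE _ _ nij.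
rewrite (sS _ _ nij) in Sxy; have := set21 x y; have := set22 x y; rewrite -Sxy.
by move: nxy => /[swap] /set2P[]-> /[swap] /set2P[]->; rewrite ?eqxx // tpermC.
Qed.

(** Pairing with [tperm i j] controls the sum of the two symmetric entries minus
two diagonal ones; summing over [j] separates the diagonal, since the row and
column sums are known. *)
Lemma trace_isometry_symmetrized (R : realType) n (psi : 'M[R]_n -> 'M[R]_n) :
  trace_isometry psi ->
  (forall i j, i != j -> psi (perm_mx (tperm i j)) = perm_mx (tperm i j)) ->
  forall A, doubly_stochastic R n A ->
    (forall i, psi A i i = A i i) /\
    (forall i j, psi A i j + psi A j i = A i j + A j i).
Proof.
move=> [psiDS psitr psimul] psiT A Ads.
have sym i j : psi A i j + psi A j i - psi A i i - psi A j j =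
               A i j + A j i - A i i - A j j.
  have [->|nij] := eqVneq i j; first by ring.
  have := psimul _ _ Ads (doubly_stochastic_perm R (tperm i j)).
  rewrite psiT // !mxtrace_mul_tperm psitr // => e.
  by apply: (addrI (\tr A)); rewrite !addrA.
have diag i : psi A i i = A i i.
  have sum (X : 'M[R]_n) : doubly_stochastic R n X ->
      \sum_j (X i j + X j i - X i i - X j j) = 2 - X i i *+ n - \tr X.
    move=> [_ Xr Xc]; rewrite !sumrB big_split /= Xr Xc sumr_const card_ord.
    by rewrite -/(\tr X).
  have n0 : (n == 0%N) = false.
    by apply/negbTE; rewrite -lt0n (leq_ltn_trans _ (ltn_ord i)).
  have /eqP := sum _ (psiDS _ Ads).
  rewrite (eq_bigr _ (fun j _ => sym i j)) sum //.
  rewrite psitr // (inj_eq (addIr _)) (inj_eq (addrI _)) eqr_opp.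
  by rewrite -subr_eq0 -mulrnBl mulrn_eq0 n0 subr_eq0 => /eqP.
by split=> // i j; have := sym i j; rewrite !diag => /addIr/addIr.
Qed.

(** The cycle relations say that [M k l = M o l - M o k], as for a closed 1-form;
summing over [l] then kills the potential [M o]. *)
Lemma antisym_cycle3_eq0 (F : numDomainType) n (o : 'I_n) (M : 'M[F]_n) :
  (forall i j, M i j + M j i = 0) -> (forall i, \sum_j M i j = 0) ->
  (forall k l, o != k -> k != l -> o != l ->
     M k o + M l k + M o l = 0) ->
  M = 0.
Proof.
move=> Manti Mrow Mcyc.
have MN i j : M i j = - M j i by apply/eqP; rewrite -addr_eq0 Manti.
have M0 i : M i i = 0.
  by apply/eqP; have /eqP := Manti i i; rewrite -mulr2n mulrn_eq0.
have cyc k l : M k l = M o l - M o k.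
  have [->|nok] := eqVneq o k; first by rewrite M0 subr0.
  have [->|nol] := eqVneq o l; first by rewrite M0 sub0r -MN.
  have [->|nkl] := eqVneq k l; first by rewrite M0 subrr.
  have /eqP := Mcyc k l nok nkl nol; rewrite (MN k o) (MN l k) addrAC subr_eq0.
  by rewrite addrC => /eqP.
have Mo k : M o k = 0.
  have := Mrow k; under eq_bigr do rewrite cyc.
  rewrite sumrB Mrow sumr_const card_ord sub0r => /eqP.
  have n0 : (n == 0%N) = false.
    by apply/negbTE; rewrite -lt0n (leq_ltn_trans _ (ltn_ord o)).
  by rewrite oppr_eq0 mulrn_eq0 n0 => /eqP.
by apply/matrixP=> k l; rewrite cyc !Mo mxE subrr.
Qed.

(** The symmetrised matrix of a 3-cycle records the triangle but not its
orientation. *)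
Lemma cycle3_or_inverse (n : nat) (i j k : 'I_n) (q : 'S_n) :
  i != j -> j != k -> i != k ->
  (forall a b, (q a == b) + (q b == a) =
     (cycle3 i j k a == b) + (cycle3 i j k b == a))%N ->
  q = cycle3 i j k \/ q = cycle3 i k j.
Proof.
move=> nij njk nik qc.
have [nji nkj nki] : [/\ j != i, k != j & k != i] by split; rewrite eq_sym.
have cE := cycle3E _ nij njk nik.
have cE' := cycle3E _ nik nkj nij.
have ci : cycle3 i j k i = j by rewrite cE eqxx.
have cj : cycle3 i j k j = k by rewrite cE (negPf nji) eqxx.
have ck : cycle3 i j k k = i by rewrite cE (negPf nki) (negPf nkj) eqxx.
have edge a b : cycle3 i j k a = b -> q a = b \/ q b = a.
  move=> cab; have := qc a b; rewrite cab eqxx.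
  by case: (q a =P b) => [|_]; [left|case: (q b =P a) => [|_ //]; right].
have qfix x : x != i -> x != j -> x != k -> q x = x.
  move=> nxi nxj nxk; have cx : cycle3 i j k x = x.
    by rewrite cE (negPf nxi) (negPf nxj) (negPf nxk).
  by have [] := edge _ _ cx.
have [qi|qj] := edge _ _ ci.
  have qj : q j = k.
    case: (edge _ _ cj) => // qk.
    by move: nki; rewrite -(inj_eq (@perm_inj _ q)) qi qk eqxx.
  have qk : q k = i.
    by case: (edge _ _ ck) => // e; move: njk; rewrite -qi e eqxx.
  left; apply/permP=> x; rewrite cE.
  case: eqVneq => [->//|nxi]; case: eqVneq => [->//|nxj].
  case: eqVneq => [->//|nxk].
  exact: qfix.
have qi : q i = k.
  case: (edge _ _ ck) => // qk.
  by move: nkj; rewrite -(inj_eq (@perm_inj _ q)) qk qj eqxx.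
have qk : q k = j.
  by case: (edge _ _ cj) => // e; move: nik; rewrite -qj e eqxx.
right; apply/permP=> x; rewrite cE'.
case: eqVneq => [->//|nxi]; case: eqVneq => [->//|nxj].
case: eqVneq => [->//|nxk].
exact: qfix.
Qed.

(** The product of two 3-cycles whose only common points are [o] and [k] has
[n - 4] fixed points if they run through that edge in the same direction and
[n - 3] otherwise, so fixing one while inverting the other would change a trace.
Moves of this kind and reversals connect all the 3-cycles through [o]. *)
Lemma trace_isometry_cycle3 (R : realType) n (psi : 'M[R]_n -> 'M[R]_n)
    (o : 'I_n) :
  trace_isometry psi ->
  (forall i j, i != j -> psi (perm_mx (tperm i j)) = perm_mx (tperm i j)) ->
  (forall k l, o != k -> k != l -> o != l ->
     psi (perm_mx (cycle3 o k l)) = perm_mx (cycle3 o k l)) \/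
  (forall k l, o != k -> k != l -> o != l ->
     psi (perm_mx (cycle3 o k l)) = perm_mx (cycle3 o l k)).
Proof.
move=> psiP psiT; have [f fP] := trace_isometry_perm psiP.
have symA := trace_isometry_symmetrized psiP psiT.
have [psiDS psitr psimul] := psiP.
have Pds (s : 'S_n) := doubly_stochastic_perm R s.
have tr2 s t : \tr (perm_mx (f s) *m perm_mx (f t) : 'M[R]_n) =
               \tr (perm_mx s *m perm_mx t) by rewrite -!fP psimul.
have dich k l : o != k -> k != l -> o != l ->
    f (cycle3 o k l) = cycle3 o k l \/ f (cycle3 o k l) = cycle3 o l k.
  move=> nok nkl nol; apply: cycle3_or_inverse => // a b.
  have [_ /(_ a b)] := symA _ (Pds (cycle3 o k l)).
  by rewrite fP !perm_mxE -!natrD => /eqP; rewrite eqr_nat => /eqP.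
pose O k l := f (cycle3 o k l) == cycle3 o k l.
have flip k l : o != k -> k != l -> o != l -> O k l -> O l k.
  move=> nok nkl nol /eqP Okl.
  have [nko nlk nlo] : [/\ k != o, l != k & l != o] by split; rewrite eq_sym.
  have [/eqP//|e] := dich _ _ nol nlk nok.
  have := tr2 (cycle3 o k l) (cycle3 o l k); rewrite Okl e.
  rewrite !mxtrace_mul_cycle3 // !perm_mxE !cycle3E // ?eqxx.
  do 2! rewrite ?(negPf nok) ?(negPf nko) ?(negPf nkl) ?(negPf nlk)
    ?(negPf nol) ?(negPf nlo) ?eqxx.
  by move: (\tr _) => t /= h; exfalso; clear -h; lra.
have step k l m : o != k -> k != l -> o != l -> k != m -> o != m ->
    O k l -> O k m.
  move=> nok nkl nol nkm nom; have [<-//|nlm] := eqVneq l m; move=> /eqP Okl.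
  have [nko nlk nlo] : [/\ k != o, l != k & l != o] by split; rewrite eq_sym.
  have [nmk nmo nml] : [/\ m != k, m != o & m != l] by split; rewrite eq_sym.
  have [/eqP//|e] := dich _ _ nok nkm nom.
  have := tr2 (cycle3 o k l) (cycle3 o k m); rewrite Okl e.
  rewrite !mxtrace_mul_cycle3 // !perm_mxE !cycle3E // ?eqxx.
  do 2! rewrite ?(negPf nok) ?(negPf nko) ?(negPf nkl) ?(negPf nlk)
    ?(negPf nol) ?(negPf nlo) ?(negPf nkm) ?(negPf nmk) ?(negPf nom)
    ?(negPf nmo) ?(negPf nlm) ?(negPf nml) ?eqxx.
  by move: (\tr _) => t /= h; exfalso; clear -h; lra.
have all k l a b : o != k -> k != l -> o != l -> O k l ->
    o != a -> a != b -> o != b -> O a b.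
  move=> nok nkl nol Okl noa nab nob.
  have [eak|nka] := eqVneq k a.
    by rewrite -eak in nab *; apply: (step k l).
  have nak : a != k by rewrite eq_sym.
  apply: (step a k) => //; apply: flip => //; exact: (step k l).
have [/existsP[k /existsP[l /and4P[nok nkl nol Okl]]]|none] :=
    boolP [exists k, exists l, [&& o != k, k != l, o != l & O k l]].
  left=> a b noa nab nob.
  by rewrite fP (eqP (all k l a b nok nkl nol Okl noa nab nob)).
right=> k l nok nkl nol; rewrite fP; have [e|-> //] := dich _ _ nok nkl nol.
case/negP: none; apply/existsP; exists k; apply/existsP; exists l.
by rewrite nok nkl nol /O e eqxx.
Qed.

Lemma trace_isometry_fix_tperm (R : realType) n (psi : 'M[R]_n -> 'M[R]_n) :
  trace_isometry psi ->
  (forall i j, i != j -> psi (perm_mx (tperm i j)) = perm_mx (tperm i j)) ->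
  (forall A, doubly_stochastic R n A -> psi A = A) \/
  (forall A, doubly_stochastic R n A -> psi A = A^T).
Proof.
case: n psi => [|n] psi psiP psiT; first by left=> A _; apply/matrixP => [[]].
have symA := trace_isometry_symmetrized psiP psiT.
have [psiDS psitr psimul] := psiP.
have Pds (s : 'S_n.+1) := doubly_stochastic_perm R s.
have zero_rows (X Y : 'M[R]_n.+1) :
    doubly_stochastic R _ X -> doubly_stochastic R _ Y ->
    forall i, \sum_j (X - Y) i j = 0.
  move=> [_ Xr _] [_ Yr _] i; under eq_bigr do rewrite !mxE.
  by rewrite sumrB Xr Yr subrr.
have [cyc|cyc] := trace_isometry_cycle3 ord0 psiP psiT; [left|right] => A Ads;
  have [diag sym] := symA _ Ads; apply/eqP; rewrite -subr_eq0; apply/eqP.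
  apply: (@antisym_cycle3_eq0 _ _ ord0); last move=> k l nok nkl nol.
  - by move=> i j; rewrite !mxE addrACA sym; ring.
  - by apply: zero_rows => //; exact: psiDS.
  have := psimul _ _ Ads (Pds (cycle3 ord0 k l)); rewrite cyc //.
  rewrite !mxtrace_mul_cycle3 // psitr // !diag => e; rewrite !mxE.
  by clear -e; lra.
apply: (@antisym_cycle3_eq0 _ _ ord0); last move=> k l nok nkl nol.
- by move=> i j; rewrite !mxE addrACA sym; ring.
- by apply: zero_rows; [exact: psiDS|exact: doubly_stochastic_tr].
have nlk : l != k by rewrite eq_sym.
have := psimul _ _ Ads (Pds (cycle3 ord0 l k)); rewrite cyc //.
rewrite !mxtrace_mul_cycle3 // psitr // !diag => e; rewrite !mxE.
by clear -e; lra.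
Qed.

Lemma doubly_stochastic_conj_perm (R : realType) n (s : 'S_n) (A : 'M[R]_n) :
  doubly_stochastic R n A ->
  doubly_stochastic R n (perm_mx s *m A *m (perm_mx s)^T).
Proof.
move=> Ads; rewrite tr_perm_mx.
have Pds t := @doubly_stochastic_perm R n t.
by apply: doubly_stochastic_mul => //; apply: doubly_stochastic_mul.
Qed.

Lemma perm_mx_trK (F : comNzRingType) n (s : 'S_n) :
  perm_mx s *m (perm_mx s)^T = 1%:M :> 'M[F]_n.
Proof. by rewrite tr_perm_mx -perm_mxM mulgV perm_mx1. Qed.

(** * Trace isometries and spectrum preservers *)

(** Conjugating by the vertex permutation reduces to a map that fixes the
transpositions. *)
Theorem trace_isometryP (R : realType) n (psi : 'M[R]_n -> 'M[R]_n) :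
  trace_isometry psi -> exists s : 'S_n,
    (forall A, doubly_stochastic R n A ->
       psi A = perm_mx s *m A *m (perm_mx s)^T) \/
    (forall A, doubly_stochastic R n A ->
       psi A = perm_mx s *m A^T *m (perm_mx s)^T).
Proof.
move=> psiP; have [s sT] := trace_isometry_tperm psiP.
have [psiDS psitr psimul] := psiP.
pose P : 'M[R]_n := perm_mx s; pose chi A := P *m psi A *m P^T.
have PTP : P^T *m P = 1%:M by rewrite tr_perm_mx -perm_mxM mulVg perm_mx1.
have chiP : trace_isometry chi.
  split=> [A Ads|A Ads|A B Ads Bds].
  - by apply: doubly_stochastic_conj_perm; apply: psiDS.
  - by rewrite /chi -mulmxA mxtrace_mulC -mulmxA PTP mulmx1 psitr.
  rewrite /chi !mulmxA -(mulmxA _ P^T P) PTP mulmx1.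
  by rewrite mxtrace_mulC !mulmxA PTP mul1mx psimul.
have chiT i j : i != j -> chi (perm_mx (tperm i j)) = perm_mx (tperm i j).
  move=> nij; rewrite /chi sT // tr_perm_mx -!perm_mxM.
  by rewrite -{1}(invgK s) -mulgA -conjgE tpermJ !permK.
have psiE A : psi A = perm_mx s^-1 *m chi A *m (perm_mx s^-1)^T.
  rewrite /chi -!tr_perm_mx trmxK -/P !mulmxA PTP mul1mx.
  by rewrite -mulmxA PTP mulmx1.
exists s^-1%g.
by case: (trace_isometry_fix_tperm chiP chiT) => chiE; [left|right] => A Ads;
   rewrite psiE chiE.
Qed.

(** Midpoints stay inside the doubly stochastic matrices, so they are all that the
polarisation needs from linearity. *)
Lemma linear_on_midpoint (R : realType) n (phi : 'M[R]_n -> 'M[R]_n) :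
  linear_on (doubly_stochastic R n) (doubly_stochastic R n) phi ->
  forall A B, doubly_stochastic R n A -> doubly_stochastic R n B ->
    doubly_stochastic R n (2^-1 *: (A + B)) /\
    phi (2^-1 *: (A + B)) = 2^-1 *: (phi A + phi B).
Proof.
move=> [L [_ Llin Lphi]] A B Ads Bds.
have Cds : doubly_stochastic R n (2^-1 *: (A + B)).
  have [A0 Ar Ac] := Ads; have [B0 Br Bc] := Bds.
  have half : 2^-1 * (1 + 1) = 1 :> R by rewrite mulVf // pnatr_eq0.
  split=> [i j|i|j]; first by rewrite !mxE mulr_ge0 ?invr_ge0 ?ler0n ?addr_ge0.
    by under eq_bigr do rewrite !mxE; rewrite -mulr_sumr big_split /= Ar Br.
  by under eq_bigr do rewrite !mxE; rewrite -mulr_sumr big_split /= Ac Bc.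
have span1 X : doubly_stochastic R n X -> real_span (doubly_stochastic R n) X.
  move=> Xds; exists 1%N, (fun=> 1), (fun=> X); split=> //.
  by rewrite big_ord1 scale1r.
have span0 : real_span (doubly_stochastic R n) 0.
  by exists 0%N, (fun=> 1), (fun=> A); split=> //; rewrite big_ord0.
have spanB : real_span (doubly_stochastic R n) (2^-1 *: B).
  by exists 1%N, (fun=> 2^-1), (fun=> B); split=> //; rewrite big_ord1.
have L0 : L 0 = 0.
  have := Llin 1 0 0 span0 span0; rewrite !scale1r addr0 => e.
  by apply: (addrI (L 0)); rewrite addr0.
split=> //; rewrite -Lphi // scalerDr Llin //; try exact: span1.
rewrite -[_ *: B]addr0 Llin //; last exact: span1.
by rewrite L0 addr0 !Lphi // scalerDr.
Qed.

Lemma trace_isometry_of_spec (R : realType) n (phi : 'M[R]_n -> 'M[R]_n) :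
  (forall A, doubly_stochastic R n A -> doubly_stochastic R n (phi A)) ->
  linear_on (doubly_stochastic R n) (doubly_stochastic R n) phi ->
  (forall A, doubly_stochastic R n A -> spec (phi A) = spec A) ->
  trace_isometry phi.
Proof.
move=> phiDS philin phispec.
have phichar A : doubly_stochastic R n A -> char_poly (phi A) = char_poly A.
  by move=> Ads; apply/spec_char_polyP/phispec.
split=> // [A Ads|A B Ads Bds]; first exact/char_poly_mxtrace/phichar.
have [Cds phiC] := linear_on_midpoint philin Ads Bds.
have sqr X : doubly_stochastic R n X -> \tr (phi X *m phi X) = \tr (X *m X).
  by move=> Xds; apply/char_poly_mxtrace_sqr/phichar.
have trC (X Y : 'M[R]_n) : \tr (2^-1 *: (X + Y) *m (2^-1 *: (X + Y))) =
    2^-1 * (2^-1 * (\tr (X *m X) + \tr (Y *m Y) + 2 * \tr (X *m Y))).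
  rewrite -scalemxAl -scalemxAr !mxtraceZ mulmxDl !mulmxDr !mxtraceD.
  by rewrite (mxtrace_mulC Y X); ring.
have := sqr _ Cds; rewrite phiC !trC !sqr // => e.
by clear -e; lra.
Qed.

Theorem theorem3p1 (R : realType) (n : nat) (n_gt0 : (0 < n)%N)
    (phi : 'M[R]_n -> 'M[R]_n)
    (phi_DS : forall A, doubly_stochastic R n A -> doubly_stochastic R n (phi A))
    (phi_linear :
       linear_on (doubly_stochastic R n) (doubly_stochastic R n) phi) :
  (forall A, doubly_stochastic R n A -> spec (phi A) = spec A) <->
  (exists P : 'M[R]_n, is_perm_mx P /\
     ((forall A, doubly_stochastic R n A -> phi A = P *m A *m P^T) \/
      (forall A, doubly_stochastic R n A -> phi A = P *m A^T *m P^T))).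
Proof.
split=> [phispec|[P [/is_perm_mxP[s ->] phiE]] A Ads].
  have phiP := trace_isometry_of_spec phi_DS phi_linear phispec.
  have [s phiE] := trace_isometryP phiP.
  by exists (perm_mx s); split=> //; apply: perm_mx_is_perm.
apply/spec_char_polyP.
by case: phiE => -> //; rewrite char_poly_conj ?perm_mx_trK // char_poly_tr.
Qed.
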